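(* Let $[p_1,p_2,\pi]\in\mathrm{Bilin}_{d_1,d_2,d_3}^{r_1,r_2}(\mathbb{A}^n)(k)$, with $F_1=S^{\oplus r_1}$, $F_2=S^{\oplus r_2}$, $F_3=S^{\oplus r_1r_2}=F_1\otimes_SF_2$, $p_i\colon F_i\twoheadrightarrow M_i=F_i/K_i$ for $i=1,2$, $\pi\colon M_1\otimes_SM_2\twoheadrightarrow M_3$, and $M_3=F_3/K_3$, where $K_3$ is the kernel of $p_3=\pi\circ(p_1\otimes p_2)\colon F_3\to M_3$. Then the tangent space to $\mathrm{Bilin}_{d_1,d_2,d_3}^{r_1,r_2}(\mathbb{A}^n)$ at $[p_1,p_2,\pi]$ consists of those elements $$(\varphi_1,\varphi_2,\varphi_3)\in\operatorname{Hom}_S(K_1,M_1)\times\operatorname{Hom}_S(K_2,M_2)\times\operatorname{Hom}_S(K_3,M_3)$$ such that the following two equalities of maps hold: $$\varphi_3\circ j_1=\pi\circ(\mathrm{id}_{M_1}\otimes p_2)\circ(\varphi_1\otimes\mathrm{id}_{F_2})\colon K_1\otimes F_2\to M_3,$$ $$\varphi_3\circ j_2=\pi\circ(p_1\otimes\mathrm{id}_{M_2})\circ(\mathrm{id}_{F_1}\otimes\varphi_2)\colon F_1\otimes K_2\to M_3,$$ where $j_1\colon K_1\otimes F_2\hookrightarrow K_3$ and $j_2\colon F_1\otimes K_2\hookrightarrow K_3$ are the inclusions. In other words, for all $k_1\otimes f_2\in K_1\otimes F_2$ and $f_1\otimes k_2\in F_1\otimes K_2$, one has $\varphi_3(k_1\otimes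 f_2)=\varphi_1(k_1)\otimes f_2+K_3$ and $\varphi_3(f_1\otimes k_2)=f_1\otimes\varphi_2(k_2)+K_3$ in $F_3/K_3$.
   Context: Let $k$ be an infinite algebraically closed field, $S=k[x_1,\dots,x_n]$, $\mathbb{A}^n=\operatorname{Spec}S$, $S_A=S\otimes_kA$ for a $k$-algebra $A$; $n,d_i,r_i\ge1$ are integers. For a $k$-algebra $A$, $\mathrm{Bilin}_{d_1,d_2,d_3}^{r_1,r_2}(\mathbb{A}^n)(A)$ is the set of triples $[p_1,p_2,\pi]$ of $S_A$-linear surjections $p_i\colon S_A^{\oplus r_i}\twoheadrightarrow M_i$ ($i=1,2$) and $\pi\colon M_1\otimes_{S_A}M_2\twoheadrightarrow M_3$ with $M_j$ locally free of rank $d_j$ over $A$ ($j=1,2,3$), surjections with equal kernels being identified. Similarly $\mathrm{Quot}_d^r(\mathbb{A}^n)(A)$ is the set of $S_A$-linear surjections $S_A^{\oplus r}\twoheadrightarrow M$ with $M$ locally free of rank $d$ over $A$, up to equality of kernels. Sending $[p_1,p_2,\pi]$ to $[p_1,p_2,\pi\circ(p_1\otimes p_2)]$ embeds the Bilinear functor as a subfunctor of $\mathcal{Q}=\mathrm{Quot}_{d_1}^{r_1}(\mathbb{A}^n)\times\mathrm{Quot}_{d_2}^{r_2}(\mathbb{A}^n)\times\mathrm{Quot}_{d_3}^{r_1r_2}(\mathbb{A}^n)$. The tangent space to a functor $G$ at $p\in G(k)$ is the set of elements of $G(k[\varepsilon])$, $k[\varepsilon]=k[t]/(t^2)$, that restrict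 to $p$ under $k[\varepsilon]\to k$, $\varepsilon\mapsto0$. The tangent space to $\mathrm{Quot}_d^r(\mathbb{A}^n)$ at $[F=S^{\oplus r}\twoheadrightarrow M=F/K]$ is identified with $\operatorname{Hom}_S(K,M)$: a map $\varphi\colon K\to M$ corresponds to the quotient $F\otimes_kk[\varepsilon]\twoheadrightarrow (F\otimes_kk[\varepsilon])/\widetilde K$ with $\widetilde K=\{k+\varepsilon g\mid k\in K,\ g\in F,\ g+K=\varphi(k)\}$. Accordingly the tangent space to $\mathcal{Q}$ at $[p_1,p_2,p_3]$ is identified with $\prod_{i=1}^3\operatorname{Hom}_S(K_i,M_i)$, and the tangent space to the Bilinear functor is viewed as a subset of it via the embedding into $\mathcal{Q}$. The expressions $\varphi_1(k_1)\otimes f_2+K_3$ and $f_1\otimes\varphi_2(k_2)+K_3$ denote the images $\pi(\varphi_1(k_1)\otimes p_2(f_2))$ and $\pi(p_1(f_1)\otimes\varphi_2(k_2))$ in $M_3=F_3/K_3$. *)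

(* Defs.v *)
Set Warnings "-notation-overridden,-ambiguous-paths,-notation-incompatible-prefix,-redundant-canonical-projection,-projection-no-head-constant".
From HB Require Import structures.
From mathcomp Require Import all_boot all_order all_algebra.
From mathcomp Require Import generic_quotient ring_quotient.
From mathcomp Require Import boolp.
From mathcomp Require Import freeg mpoly ring.

Set Implicit Arguments.
Unset Strict Implicit.
Unset Printing Implicit Defensive.
Import GRing.Theory.
Local Open Scope ring_scope.
Local Open Scope quotient_scope.

Section Kernel.
Context (R : comNzRingType) (V W : lmodType R) (f : {linear V -> W}).

Definition ker_pred : {pred V} := fun x => f x == 0.

Fact ker_submod_closed : submod_closed ker_pred.
Proof.
split=> [|a x y]; rewrite /ker_pred !unfold_in ?linear0 //.
by move=> /eqP fx /eqP fy; rewrite linearP fx fy scaler0 addr0.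
Qed.

HB.instance Definition _ := GRing.isSubmodClosed.Build R V ker_pred
  ker_submod_closed.

Record kernel := Kernel { ker_val : V; _ : ker_val \in ker_pred }.

HB.instance Definition _ := [isSub for ker_val].
HB.instance Definition _ := [Choice of kernel by <:].
HB.instance Definition _ := [SubChoice_isSubLmodule of kernel by <:].

Lemma ker_valP (x : kernel) : f (ker_val x) = 0.
Proof. by case: x => x fx /=; apply/eqP. Qed.

Fact ker_val_linear : linear ker_val. Proof. by []. Qed.
HB.instance Definition _ := GRing.isLinear.Build R kernel V *:%R ker_val
  ker_val_linear.

End Kernel.

Section KernelLift.
Context (R : comNzRingType) (U V W : lmodType R).
Context (f : {linear V -> W}) (g : {linear U -> V}).
Hypothesis fg0 : forall x, f (g x) = 0.

Fact ker_lift_subproof x : g x \in ker_pred f.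
Proof. exact/eqP/fg0. Qed.

Definition ker_lift x : kernel f := Kernel (ker_lift_subproof x).

Fact ker_lift_linear : linear ker_lift.
Proof. by move=> a x y; apply: val_inj; rewrite /= linearP. Qed.
HB.instance Definition _ := GRing.isLinear.Build R U (kernel f) *:%R ker_lift
  ker_lift_linear.

End KernelLift.

Section Tensor.
Context (R : comNzRingType) (M N : lmodType R).

(** The submodule of the free module on [M * N] generated by the bilinearity
    relations. *)
Inductive tens_null : {freeg (M * N) / R} -> Prop :=
| TensDl x x' y : tens_null (<< (x + x', y) >> - (<< (x, y) >> + << (x', y) >>))
| TensDr x y y' : tens_null (<< (x, y + y') >> - (<< (x, y) >> + << (x, y') >>))
| TensZl a x y : tens_null (<< (a *: x, y) >> - a *: << (x, y) >>)
| TensZr a x y : tens_null (<< (x, a *: y) >> - a *: << (x, y) >>)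
| Tens0 : tens_null 0
| TensP a u v : tens_null u -> tens_null v -> tens_null (a *: u + v).

Definition tens_null_pred : {pred {freeg (M * N) / R}} :=
  fun t => `[< tens_null t >].

Fact tens_null_zmod_closed : zmod_closed tens_null_pred.
Proof.
split=> [|u v]; first exact/asboolP/Tens0.
move=> /asboolP nu /asboolP nv; apply/asboolP.
by rewrite addrC -scaleN1r; apply: TensP.
Qed.
HB.instance Definition _ := GRing.isZmodClosed.Build _ tens_null_pred
  tens_null_zmod_closed.

Definition tens := Quotient.quot tens_null_pred.
HB.instance Definition _ := GRing.Zmodule.on tens.
HB.instance Definition _ := EqQuotient.on tens.

Local Notation proj := (\pi_tens : {freeg (M * N) / R} -> tens).

Lemma tens_projB u v : proj (u - v) = proj u - proj v.
Proof. by rewrite [LHS](raddfB \pi_(Quotient.quot tens_null_pred)). Qed.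

Lemma tens_projD u v : proj (u + v) = proj u + proj v.
Proof. by rewrite [LHS](raddfD \pi_(Quotient.quot tens_null_pred)). Qed.

Lemma tens_projE u v : proj u = proj v <-> tens_null (u - v).
Proof.
split=> [/eqP|uv]; last apply/eqP.
  by rewrite -Quotient.idealrBE => /asboolP.
by rewrite -Quotient.idealrBE; apply/asboolP.
Qed.

Lemma tens_reprK (t : tens) : proj (repr t) = t.
Proof. exact: reprK. Qed.

Definition tens_scale (a : R) (t : tens) : tens := proj (a *: repr t).

Lemma tens_projZ a u : tens_scale a (proj u) = proj (a *: u).
Proof.
apply/tens_projE; rewrite -scalerBr -[_ *: _]addr0.
by apply: TensP Tens0; apply/tens_projE; rewrite tens_reprK.
Qed.

Fact tens_scaleA a b t : tens_scale a (tens_scale b t) = tens_scale (a * b) t.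
Proof. by rewrite -[t]tens_reprK !tens_projZ scalerA. Qed.
Fact tens_scale1 : left_id 1 tens_scale.
Proof. by move=> t; rewrite -[t]tens_reprK tens_projZ scale1r. Qed.
Fact tens_scaleDr : right_distributive tens_scale +%R.
Proof.
move=> a t u; rewrite -[t]tens_reprK -[u]tens_reprK.
by rewrite -tens_projD !tens_projZ -tens_projD scalerDr.
Qed.
Fact tens_scaleDl t : {morph tens_scale^~ t : a b / a + b}.
Proof.
by move=> a b; rewrite -[t]tens_reprK !tens_projZ -tens_projD scalerDl.
Qed.
HB.instance Definition _ := GRing.Zmodule_isLmodule.Build R tens
  tens_scaleA tens_scale1 tens_scaleDr tens_scaleDl.

Definition pure (x : M) (y : N) : tens := proj << (x, y) >>.

Lemma pureDl x x' y : pure (x + x') y = pure x y + pure x' y.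
Proof. by rewrite -tens_projD; apply/tens_projE/TensDl. Qed.
Lemma pureDr x y y' : pure x (y + y') = pure x y + pure x y'.
Proof. by rewrite -tens_projD; apply/tens_projE/TensDr. Qed.
Lemma pureZl a x y : pure (a *: x) y = a *: pure x y.
Proof.
by rewrite [RHS]tens_projZ; apply/tens_projE/TensZl.
Qed.
Lemma pureZr a x y : pure x (a *: y) = a *: pure x y.
Proof.
by rewrite [RHS]tens_projZ; apply/tens_projE/TensZr.
Qed.

Lemma pure0l y : pure 0 y = 0.
Proof. by rewrite -(scale0r 0) pureZl scale0r. Qed.
Lemma pure0r x : pure x 0 = 0.
Proof. by rewrite -(scale0r 0) pureZr scale0r. Qed.

Lemma pure_suml I (r : seq I) (P : pred I) (F : I -> M) y :
  pure (\sum_(i <- r | P i) F i) y = \sum_(i <- r | P i) pure (F i) y.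
Proof. exact: (big_morph (pure^~ y) (fun x x' => pureDl x x' y) (pure0l y)). Qed.
Lemma pure_sumr I (r : seq I) (P : pred I) x (F : I -> N) :
  pure x (\sum_(i <- r | P i) F i) = \sum_(i <- r | P i) pure x (F i).
Proof. exact: (big_morph (pure x) (pureDr x) (pure0r x)). Qed.

Lemma tens_ind (P : tens -> Prop) :
  (forall x y, P (pure x y)) -> P 0 ->
  (forall a t u, P t -> P u -> P (a *: t + u)) -> forall t, P t.
Proof.
move=> Ppure P0 PP t; rewrite -[t]tens_reprK -[repr t]freeg_sumE.
have projS r : proj (\sum_(z <- r) << coeff z (repr t) *g z >>)
    = \sum_(z <- r) (coeff z (repr t) *: pure z.1 z.2).
  elim: r => [|z r IHr].
    by rewrite !big_nil; exact: (raddf0 \pi_(Quotient.quot tens_null_pred)).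
  rewrite !big_cons tens_projD IHr; congr (_ + _).
  rewrite [RHS]tens_projZ -surjective_pairing; congr (proj _).
  by apply/eqP/freeg_eqP=> w; rewrite coeffZ !coeffU mul1r.
rewrite projS; elim: (dom _) => [|z r IHr]; first by rewrite big_nil.
by rewrite big_cons; apply: PP.
Qed.

End Tensor.

Notation "x ⊗ y" := (pure x y) (at level 40, left associativity) : ring_scope.

Lemma fglift_linear (R : nzRingType) (K : choiceType) (P : lmodType R)
    (f : K -> P) : linear (fglift f).
Proof.
have lB u v : fglift f (u - v) = fglift f u - fglift f v.
  exact: lift_is_additive.
have l0 : fglift f 0 = 0 by rewrite -[in LHS](subrr 0) lB subrr.
have lD u v : fglift f (u + v) = fglift f u + fglift f v.
  by rewrite -{1}[v]opprK -[- v]sub0r !lB l0 sub0r opprK.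
move=> a u v; rewrite lD; congr (_ + _).
rewrite -[u in RHS]freeg_sumE [a *: u]/(fgscale a u) /fgscale.
elim: (dom u) => [|z r IHr]; first by rewrite !big_nil l0 scaler0.
by rewrite !big_cons !lD !liftU IHr scalerDr scalerA.
Qed.
HB.instance Definition _ (R : nzRingType) (K : choiceType) (P : lmodType R)
  (f : K -> P) := GRing.isLinear.Build R {freeg K / R} P *:%R (fglift f)
    (fglift_linear f).

Section TensorLift.
Context (R : comNzRingType) (M N P : lmodType R) (f : M -> N -> P).
Context (flinl : forall y, linear (f^~ y)) (flinr : forall x, linear (f x)).

Local Notation lft := (fglift (fun z : M * N => f z.1 z.2)).

Lemma fglift_tens_null u : tens_null u -> lft u = 0.
Proof.
have fDl x x' y : f (x + x') y = f x y + f x' y.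
  by have := flinl y 1 x x'; rewrite !scale1r.
have fDr x y y' : f x (y + y') = f x y + f x y'.
  by have := flinr x 1 y y'; rewrite !scale1r.
have f0l y : f 0 y = 0.
  by apply: (addrI (f 0 y)); rewrite -fDl !addr0.
have f0r x : f x 0 = 0.
  by apply: (addrI (f x 0)); rewrite -fDr !addr0.
elim=> {u} [x x' y|x y y'|a x y|a x y||a u v _ IHu _ IHv].
- by rewrite linearB linearD /= !liftU !scale1r /= fDl subrr.
- by rewrite linearB linearD /= !liftU !scale1r /= fDr subrr.
- rewrite linearB linearZ /= !liftU !scale1r /=.
  by have := flinl y a x 0; rewrite !addr0 f0l addr0 => ->; rewrite subrr.
- rewrite linearB linearZ /= !liftU !scale1r /=.
  by have := flinr x a y 0; rewrite !addr0 f0r addr0 => ->; rewrite subrr.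
- exact: linear0.
by rewrite linearP /= IHu IHv scaler0 addr0.
Qed.

Definition tens_lift_fun (t : tens M N) : P := lft (repr t).

Lemma tens_lift_proj u : tens_lift_fun (\pi_(tens M N) u) = lft u.
Proof.
apply/eqP; rewrite -subr_eq0 -linearB; apply/eqP/fglift_tens_null.
by apply/tens_projE; rewrite tens_reprK.
Qed.

Fact tens_lift_linear : linear tens_lift_fun.
Proof.
move=> a t u; rewrite -[t]tens_reprK -[u]tens_reprK.
rewrite [a *: _]tens_projZ -tens_projD !tens_lift_proj.
exact: linearP.
Qed.

Definition tens_lift : {linear tens M N -> P} :=
  HB.pack tens_lift_fun
    (GRing.isLinear.Build R (tens M N) P *:%R tens_lift_fun tens_lift_linear).

Lemma tens_lift_pure x y : tens_lift (x ⊗ y) = f x y.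
Proof. by rewrite /= tens_lift_proj liftU scale1r. Qed.

End TensorLift.

(* Keeps unification from unfolding the construction. *)
#[global] Opaque tens pure tens_lift.

Section TensorMap.
Context (R : comNzRingType) (M N M' N' : lmodType R).
Context (f : {linear M -> M'}) (g : {linear N -> N'}).

Fact tens_map_linl y : linear (fun x => f x ⊗ g y).
Proof. by move=> a x x'; rewrite linearP pureDl pureZl. Qed.
Fact tens_map_linr x : linear (fun y => f x ⊗ g y).
Proof. by move=> a y y'; rewrite linearP pureDr pureZr. Qed.

Definition tens_map : {linear tens M N -> tens M' N'} :=
  tens_lift (f := fun x y => f x ⊗ g y) tens_map_linl tens_map_linr.

Lemma tens_map_pure x y : tens_map (x ⊗ y) = f x ⊗ g y.
Proof. exact: tens_lift_pure. Qed.

End TensorMap.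

Lemma tens_lin_ext (R : comNzRingType) (M N P : lmodType R)
    (f g : {linear tens M N -> P}) :
  (forall x y, f (x ⊗ y) = g (x ⊗ y)) -> f =1 g.
Proof.
move=> fg; elim/tens_ind => // [|a t u IHt IHu]; first by rewrite !linear0.
by rewrite !linearP IHt IHu.
Qed.

Lemma tens_map_comp0l (R : comNzRingType) (M N M' N' M'' N'' : lmodType R)
    (f : {linear M -> M'}) (g : {linear N -> N'})
    (f' : {linear M' -> M''}) (g' : {linear N' -> N''}) t :
  (forall x, f' (f x) = 0) -> tens_map f' g' (tens_map f g t) = 0.
Proof.
move=> ff0; elim/tens_ind: t => [x y||a t u IHt IHu].
- by rewrite [X in tens_map _ _ X]tens_map_pure tens_map_pure ff0 pure0l.
- by rewrite [X in tens_map _ _ X]linear0 linear0.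
by rewrite [X in tens_map _ _ X]linearP linearP IHt IHu scaler0 addr0.
Qed.

Lemma tens_map_comp0r (R : comNzRingType) (M N M' N' M'' N'' : lmodType R)
    (f : {linear M -> M'}) (g : {linear N -> N'})
    (f' : {linear M' -> M''}) (g' : {linear N' -> N''}) t :
  (forall y, g' (g y) = 0) -> tens_map f' g' (tens_map f g t) = 0.
Proof.
move=> gg0; elim/tens_ind: t => [x y||a t u IHt IHu].
- by rewrite [X in tens_map _ _ X]tens_map_pure tens_map_pure gg0 pure0r.
- by rewrite [X in tens_map _ _ X]linear0 linear0.
by rewrite [X in tens_map _ _ X]linearP linearP IHt IHu scaler0 addr0.
Qed.

(** The identification [R^r1 ⊗ R^r2 = R^(r1 * r2)], under which [e_i ⊗ e_j] is
    the basis vector of index [mxvec_index i j]. *)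
Section Kronecker.
Context (R : comNzRingType) (r1 r2 : nat).

Fact kron_linl (y : 'rV[R]_r2) : linear (fun x : 'rV[R]_r1 => mxvec (x^T *m y)).
Proof. by move=> a x x'; rewrite !linearP /= mulmxDl -scalemxAl linearP. Qed.
Fact kron_linr (x : 'rV[R]_r1) : linear (fun y : 'rV[R]_r2 => mxvec (x^T *m y)).
Proof. by move=> a y y'; rewrite mulmxDr -scalemxAr linearP. Qed.

Definition kron : {linear tens 'rV[R]_r1 'rV[R]_r2 -> 'rV[R]_(r1 * r2)} :=
  tens_lift kron_linl kron_linr.

Lemma kron_pure x y : kron (x ⊗ y) = mxvec (x^T *m y).
Proof. exact: tens_lift_pure. Qed.

Definition unkron_fun (z : 'rV[R]_(r1 * r2)) : tens 'rV[R]_r1 'rV[R]_r2 :=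
  \sum_(i < r1) \sum_(j < r2)
    z 0 (mxvec_index i j) *: (delta_mx 0 i ⊗ delta_mx 0 j).

Fact unkron_linear : linear unkron_fun.
Proof.
move=> a x y; rewrite /unkron_fun scaler_sumr -big_split; apply: eq_bigr => i _.
rewrite scaler_sumr -big_split; apply: eq_bigr => j _.
by rewrite !mxE scalerDl scalerA.
Qed.
HB.instance Definition _ := GRing.isLinear.Build R 'rV[R]_(r1 * r2)
  (tens 'rV[R]_r1 'rV[R]_r2) *:%R unkron_fun unkron_linear.

Definition unkron : {linear 'rV[R]_(r1 * r2) -> tens 'rV[R]_r1 'rV[R]_r2} :=
  unkron_fun.

Lemma kronK : cancel kron unkron.
Proof.
apply: (@tens_lin_ext _ _ _ _ (unkron \o kron) idfun) => x y.
rewrite -[LHS]/(unkron_fun (kron (x ⊗ y))) kron_pure /unkron_fun /=.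
under eq_bigr => i _ do under eq_bigr => j _ do
  rewrite mxvecE mxE big_ord1 mxE mulrC -scalerA -pureZl -pureZr.
rewrite [in RHS](row_sum_delta x) pure_suml; apply: eq_bigr => i _.
by rewrite [in RHS](row_sum_delta y) pure_sumr.
Qed.

Lemma unkronK : cancel unkron kron.
Proof.
move=> z; rewrite -[RHS]vec_mxK [in RHS](matrix_sum_delta (vec_mx z)).
rewrite -[LHS]/(kron (unkron_fun z)) /unkron_fun !linear_sum.
apply: eq_bigr => i _; rewrite !linear_sum; apply: eq_bigr => j _.
by rewrite !linearZ kron_pure trmx_delta mul_delta_mx mxE.
Qed.

End Kronecker.
Arguments kron {R r1 r2}.
Arguments unkron {R r1 r2}.
Arguments kronK {R r1 r2}.
Arguments unkronK {R r1 r2}.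

Lemma tens_decomp_r (R : comNzRingType) (M : lmodType R) (r : nat)
    (t : tens M 'rV[R]_r) :
  exists x : 'I_r -> M, t = \sum_(j < r) x j ⊗ delta_mx 0 j.
Proof.
elim/tens_ind: t => [x y||a t u [x ->] [y ->]].
- exists (fun j => y 0 j *: x); rewrite {1}(row_sum_delta y) pure_sumr.
  by apply: eq_bigr => j _; rewrite pureZl pureZr.
- by exists (fun=> 0); rewrite big1 // => j _; rewrite pure0l.
exists (fun j => a *: x j + y j); rewrite scaler_sumr -big_split.
by apply: eq_bigr => j _; rewrite pureDl pureZl.
Qed.

Lemma tens_decomp_l (R : comNzRingType) (M : lmodType R) (r : nat)
    (t : tens 'rV[R]_r M) :
  exists x : 'I_r -> M, t = \sum_(i < r) delta_mx 0 i ⊗ x i.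
Proof.
elim/tens_ind: t => [y x||a t u [x ->] [y ->]].
- exists (fun j => y 0 j *: x); rewrite {1}(row_sum_delta y) pure_suml.
  by apply: eq_bigr => j _; rewrite pureZl pureZr.
- by exists (fun=> 0); rewrite big1 // => j _; rewrite pure0r.
exists (fun j => a *: x j + y j); rewrite scaler_sumr -big_split.
by apply: eq_bigr => j _; rewrite pureDr pureZr.
Qed.

Lemma kron_map_injl (R : comNzRingType) (r1 r2 : nat) (M : lmodType R)
    (f : {linear M -> 'rV[R]_r1}) : injective f ->
  injective (fun t : tens M 'rV[R]_r2 => kron (tens_map f idfun t)).
Proof.
move=> injf t u /(can_inj kronK) /eqP; rewrite -subr_eq0 -linearB => /eqP tu0.
apply/eqP; rewrite -subr_eq0; move: tu0; have [x ->] := tens_decomp_r (t - u).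
rewrite linear_sum => /(congr1 kron); rewrite linear0 linear_sum => x0.
rewrite big1 // => j _; suff -> : x j = 0 by rewrite pure0l.
apply: injf; rewrite linear0; apply/rowP => i; rewrite mxE.
move/rowP/(_ (mxvec_index i j)): x0; rewrite summxE mxE => <-.
rewrite (bigD1 j) //= big1 ?addr0 => [|l /negPf nlj].
  by rewrite tens_map_pure kron_pure mxvecE mxE big_ord1 !mxE !eqxx mulr1.
rewrite tens_map_pure kron_pure mxvecE mxE big_ord1 !mxE.
by rewrite [j == l]eq_sym nlj andbF mulr0.
Qed.

Lemma kron_map_injr (R : comNzRingType) (r1 r2 : nat) (M : lmodType R)
    (f : {linear M -> 'rV[R]_r2}) : injective f ->
  injective (fun t : tens 'rV[R]_r1 M => kron (tens_map idfun f t)).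
Proof.
move=> injf t u /(can_inj kronK) /eqP; rewrite -subr_eq0 -linearB => /eqP tu0.
apply/eqP; rewrite -subr_eq0; move: tu0; have [x ->] := tens_decomp_l (t - u).
rewrite linear_sum => /(congr1 kron); rewrite linear0 linear_sum => x0.
rewrite big1 // => i _; suff -> : x i = 0 by rewrite pure0r.
apply: injf; rewrite linear0; apply/rowP => j; rewrite mxE.
move/rowP/(_ (mxvec_index i j)): x0; rewrite summxE mxE => <-.
rewrite (bigD1 i) //= big1 ?addr0 => [|l /negPf nli].
  by rewrite tens_map_pure kron_pure mxvecE mxE big_ord1 !mxE !eqxx mul1r.
rewrite tens_map_pure kron_pure mxvecE mxE big_ord1 !mxE.
by rewrite [i == l]eq_sym nli mul0r.
Qed.

Lemma tens_map_surj (R : comNzRingType) (M N M' N' : lmodType R)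
    (f : {linear M -> M'}) (g : {linear N -> N'}) :
  (forall y, exists x, f x = y) -> (forall y, exists x, g x = y) ->
  forall t, exists s, tens_map f g s = t.
Proof.
move=> fs gs; elim/tens_ind => [x y||a t u [t' <-] [u' <-]].
- by have [[x' <-] [y' <-]] := (fs x, gs y); exists (x' ⊗ y'); rewrite tens_map_pure.
- by exists 0; rewrite linear0.
by exists (a *: t' + u'); rewrite linearP.
Qed.

Definition mpring (A : comNzRingType) (n : nat) : comNzRingType := {mpoly A[n]}.

Definition mpring_map (A B : comNzRingType) (n : nat) (f : {rmorphism A -> B}) :
  {rmorphism mpring A n -> mpring B n} := map_mpoly f.

Definition mpring_const (A : comNzRingType) (n : nat) :
  {rmorphism A -> mpring A n} := @mpolyC n A.

Arguments mpring_map {A B} n f.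
Arguments mpring_const {A} n.

(* Keeps instance inference from descending into the polynomial ring. *)
#[global] Opaque mpring mpring_map mpring_const.

(** A module over [A[x_1, ..., x_n]] is an [A]-module through the constant
    polynomials. The predicate [basis_away a e] says that the images of
    [e_0, ..., e_(d-1)] form a basis of the localisation [M_a] over [A_a]: with
    denominators cleared, they generate [M_a], and any linear relation between
    them has coefficients vanishing in [A_a]. Requiring the basis to come from
    [M] is no restriction, as [a] is a unit of [A_a]. *)
Definition basis_away (A : comNzRingType) (n d : nat) (M : lmodType (mpring A n))
    (a : A) (e : 'I_d -> M) : Prop :=
  (forall m : M, exists (N : nat) (c : 'I_d -> A),
      mpring_const n (a ^+ N) *: m = \sum_(i < d) mpring_const n (c i) *: e i) /\
  (forall c : 'I_d -> A, \sum_(i < d) mpring_const n (c i) *: e i = 0 ->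
      exists N : nat, forall i, a ^+ N * c i = 0).

(** Freeness of rank [d] over the members of a finite cover of [Spec A] by
    principal open subsets. *)
Definition locally_free (A : comNzRingType) (n d : nat)
    (M : lmodType (mpring A n)) : Prop :=
  exists (m : nat) (a : 'I_m -> A),
    (exists b : 'I_m -> A, \sum_(i < m) b i * a i = 1) /\
    (forall i, exists e : 'I_d -> M, basis_away (a i) e).

(** Over a [k]-algebra [A] the ring [S_A = k[x_1, ..., x_n] ⊗_k A] is
    [{mpoly A[n]}]; the [k]-algebra structure plays no further role, so the
    functors are defined on all commutative rings. Their elements are the
    records below up to [quot_eq] and [bilin_eq]. *)
Record quot (A : comNzRingType) (n d r : nat) := Quot {
  qmod : lmodType (mpring A n);
  qproj : {linear 'rV[mpring A n]_r -> qmod};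
  qproj_surj : forall y, exists x, qproj x = y;
  qmod_rank : locally_free d qmod
}.

Definition quot_eq (A : comNzRingType) (n d r : nat) (P Q : quot A n d r) : Prop :=
  forall x, qproj P x = 0 <-> qproj Q x = 0.

Record bilin (A : comNzRingType) (n d1 d2 d3 r1 r2 : nat) := Bilin {
  bquot1 : quot A n d1 r1;
  bquot2 : quot A n d2 r2;
  bmod3 : lmodType (mpring A n);
  bpi : {linear tens (qmod bquot1) (qmod bquot2) -> bmod3};
  bpi_surj : forall y, exists x, bpi x = y;
  bmod3_rank : locally_free d3 bmod3
}.

Section BilinQuot3.
Context (A : comNzRingType) (n d1 d2 d3 r1 r2 : nat).
Variable P : bilin A n d1 d2 d3 r1 r2.

Local Notation p1 := (qproj (bquot1 P)).
Local Notation p2 := (qproj (bquot2 P)).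

Definition bproj3 : {linear 'rV[mpring A n]_(r1 * r2) -> bmod3 P} :=
  bpi P \o tens_map p1 p2 \o unkron.

Lemma bproj3_kron t : bproj3 (kron t) = bpi P (tens_map p1 p2 t).
Proof. by rewrite /bproj3 -[LHS]/(bpi P (tens_map p1 p2 (unkron (kron t)))) kronK. Qed.

Lemma bproj3_surj y : exists x, bproj3 x = y.
Proof.
have [t <-] := bpi_surj y.
have [s <-] := tens_map_surj (@qproj_surj _ _ _ _ _) (@qproj_surj _ _ _ _ _) t.
by exists (kron s); rewrite bproj3_kron.
Qed.

(** With [bquot1 P] and [bquot2 P], the image of [P] in
    [Quot_d1^r1 * Quot_d2^r2 * Quot_d3^(r1 r2)]. *)
Definition bquot3 : quot A n d3 (r1 * r2) := Quot bproj3_surj (bmod3_rank P).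

Fact incl1_subproof t :
  bproj3 ((kron \o tens_map (@ker_val _ _ _ p1) idfun) t) = 0.
Proof.
rewrite -[LHS]/(bproj3 (kron (tens_map (@ker_val _ _ _ p1) idfun t))) bproj3_kron.
by rewrite tens_map_comp0l ?linear0 // => x; apply: ker_valP.
Qed.

(** [K_1 ⊗ F_2 -> F_1 ⊗ F_2 = F_3] factored through [K_3]; likewise [incl2]. *)
Definition incl1 : {linear tens (kernel p1) 'rV[mpring A n]_r2 -> kernel bproj3} :=
  ker_lift incl1_subproof.

Lemma incl1_inj : injective incl1.
Proof.
by move=> t u /(congr1 (@ker_val _ _ _ _)); apply: kron_map_injl; apply: val_inj.
Qed.

Fact incl2_subproof t :
  bproj3 ((kron \o tens_map idfun (@ker_val _ _ _ p2)) t) = 0.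
Proof.
rewrite -[LHS]/(bproj3 (kron (tens_map idfun (@ker_val _ _ _ p2) t))) bproj3_kron.
by rewrite tens_map_comp0r ?linear0 // => x; apply: ker_valP.
Qed.

Definition incl2 : {linear tens 'rV[mpring A n]_r1 (kernel p2) -> kernel bproj3} :=
  ker_lift incl2_subproof.

Lemma incl2_inj : injective incl2.
Proof.
by move=> t u /(congr1 (@ker_val _ _ _ _)); apply: kron_map_injr; apply: val_inj.
Qed.

End BilinQuot3.

Definition bilin_eq (A : comNzRingType) (n d1 d2 d3 r1 r2 : nat)
    (P Q : bilin A n d1 d2 d3 r1 r2) : Prop :=
  [/\ quot_eq (bquot1 P) (bquot1 Q), quot_eq (bquot2 P) (bquot2 Q)
    & quot_eq (bquot3 P) (bquot3 Q)].

(** [u : M -> M'] is an extension of scalars of [M] along [s], that is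
    [M' = M ⊗_R R']. For [s : S_A -> S_B] induced by [A -> B] this is
    [M ⊗_A B]. *)
Definition is_base_change (R R' : comNzRingType) (s : {rmorphism R -> R'})
    (M : lmodType R) (M' : lmodType R') (u : {linear M -> M' | s \; *:%R}) : Prop :=
  forall (N : lmodType R') (v : {linear M -> N | s \; *:%R}),
    exists w : {linear M' -> N},
      (forall x, w (u x) = v x) /\
      (forall w' : {linear M' -> N}, (forall x, w' (u x) = v x) -> w' =1 w).

(** [Q] is the image of [P] under the map induced by [f : A -> B]. *)
Definition bilin_base_change (A B : comNzRingType) (f : {rmorphism A -> B})
    (n d1 d2 d3 r1 r2 : nat) (P : bilin A n d1 d2 d3 r1 r2)
    (Q : bilin B n d1 d2 d3 r1 r2) : Prop :=
  exists (u1 : {linear qmod (bquot1 P) -> qmod (bquot1 Q) | mpring_map n f \; *:%R})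
         (u2 : {linear qmod (bquot2 P) -> qmod (bquot2 Q) | mpring_map n f \; *:%R})
         (u3 : {linear bmod3 P -> bmod3 Q | mpring_map n f \; *:%R}),
    [/\ is_base_change u1, is_base_change u2 & is_base_change u3] /\
    [/\ forall x, u1 (qproj (bquot1 P) x) = qproj (bquot1 Q) (map_mx (mpring_map n f) x),
        forall x, u2 (qproj (bquot2 P) x) = qproj (bquot2 Q) (map_mx (mpring_map n f) x)
      & forall x y, u3 (bpi P (x ⊗ y)) = bpi Q (u1 x ⊗ u2 y)].

(** [k[t]/(t^2)] *)
Notation dualnum k := {poly %/ ('X^2 : {poly k})}.

Section Dual.
Context (k : fieldType).

Definition eps : dualnum k := in_qpoly 'X^2 'X.

Lemma mk_monicX2 : mk_monic ('X^2 : {poly k}) = 'X^2.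
Proof. by rewrite /mk_monic size_polyXn monicXn. Qed.

Lemma dual_size (z : dualnum k) : (size (z : {poly k}) <= 2)%N.
Proof. by apply: leq_trans (size_npoly z) _; rewrite mk_monicX2 size_polyXn. Qed.

Lemma dual_mulE (x y : dualnum k) :
  (x : {poly k}) * y = (x`_0 * y`_0)%:P + (x`_0 * y`_1 + x`_1 * y`_0)%:P * 'X
    + (x`_1 * y`_1)%:P * 'X^2 :> {poly k}.
Proof.
have zE (z : dualnum k) : (z : {poly k}) = (z`_0)%:P + (z`_1)%:P * 'X.
  apply/polyP => -[|[|i]]; rewrite coefD coefC coefMX coefC /= ?addr0 ?add0r //.
  by rewrite nth_default // (leq_trans (dual_size z)).
rewrite {1}(zE x) {1}(zE y) !rmorphD !rmorphM /=; ring.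
Qed.

Lemma dual_coefM (x y : dualnum k) :
  ((x * y : dualnum k)`_0 = x`_0 * y`_0) *
  ((x * y : dualnum k)`_1 = x`_0 * y`_1 + x`_1 * y`_0).
Proof.
rewrite -[(x * y : dualnum k) : {poly k}]/(Pdiv.CommonRing.rmodp ((x : {poly k}) * y) (mk_monic 'X^2)).
rewrite dual_mulE.
move: (x : {poly k})`_0 (x : {poly k})`_1 (y : {poly k})`_0 (y : {poly k})`_1.
move=> x0 x1 y0 y1; rewrite mk_monicX2 Pdiv.RingMonic.rmodpD ?monicXn //.
rewrite Pdiv.RingMonic.rmodp_mull ?monicXn // addr0 Pdiv.CommonRing.rmodp_small.
  by rewrite !coefD !coefC !coefMX !coefC /= addr0 add0r.
rewrite size_polyXn ltnS (leq_trans (size_polyD _ _)) // geq_max.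
rewrite (leq_trans (size_polyC_leq1 _)) //= (leq_trans (size_polyMleq _ _)) //.
by rewrite size_polyX addn2 /= ltnS size_polyC_leq1.
Qed.

Lemma dual_inj (x y : dualnum k) : x`_0 = y`_0 -> x`_1 = y`_1 -> x = y.
Proof.
move=> e0 e1; apply/val_inj/polyP => -[|[|i]] //=.
by rewrite !nth_default // (leq_trans (dual_size _)).
Qed.

Lemma eps_coef : (eps`_0 = 0) * (eps`_1 = 1).
Proof.
rewrite -[(eps : {poly k})]/(Pdiv.CommonRing.rmodp 'X (mk_monic 'X^2)) mk_monicX2.
by rewrite Pdiv.CommonRing.rmodp_small ?size_polyX ?size_polyXn // !coefX.
Qed.

Definition dual_const : {rmorphism k -> dualnum k} := qpolyC 'X^2.

(** [eps |-> 0] *)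
Definition dual_ev_fun (z : dualnum k) : k := (z : {poly k})`_0.

Fact dual_ev_zmod_morphism : zmod_morphism dual_ev_fun.
Proof. by move=> x y; rewrite /dual_ev_fun /= coefB. Qed.
HB.instance Definition _ := GRing.isZmodMorphism.Build (dualnum k) k dual_ev_fun
  dual_ev_zmod_morphism.

Fact dual_ev_monoid_morphism : monoid_morphism dual_ev_fun.
Proof. by split=> [|x y]; rewrite /dual_ev_fun ?dual_coefM // coefC. Qed.
HB.instance Definition _ := GRing.isMonoidMorphism.Build (dualnum k) k dual_ev_fun
  dual_ev_monoid_morphism.

Definition dual_ev : {rmorphism dualnum k -> k} := dual_ev_fun.

Lemma eps_sq : eps * eps = 0.
Proof.
by apply: dual_inj; rewrite dual_coefM !eps_coef !(mulr0, mul0r) ?addr0 coefC.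
Qed.

Lemma dual_ev_eps : dual_ev eps = 0.
Proof. by rewrite -[LHS]/(eps`_0) eps_coef. Qed.

Lemma dual_ev_const c : dual_ev (dual_const c) = c.
Proof. by rewrite -[LHS]/(c%:P`_0) coefC. Qed.

Lemma dual_decomp (z : dualnum k) :
  z = dual_const z`_0 + eps * dual_const z`_1.
Proof.
have cE c : ((dual_const c)`_0 = c) * ((dual_const c)`_1 = 0).
  by split; rewrite -[LHS]/(c%:P`__) coefC.
by apply: dual_inj; rewrite coefD dual_coefM !cE !eps_coef; ring.
Qed.

End Dual.

Definition dual_constF (k : fieldType) (n r : nat) (x : 'rV[mpring k n]_r) :
    'rV[mpring (dualnum k) n]_r :=
  map_mx (mpring_map n (@dual_const k)) x.

(** The kernel of [Pt] is the submodule
    [{c + eps g | c in K, g in F, g + K = phi c}] attached to [phi : K -> M]. *)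
Definition quot_tangent_of (k : fieldType) (n d r : nat) (P : quot k n d r)
    (phi : {linear kernel (qproj P) -> qmod P}) (Pt : quot (dualnum k) n d r) : Prop :=
  forall x, qproj Pt x = 0 <->
    exists (c : kernel (qproj P)) (g : 'rV[mpring k n]_r),
      x = dual_constF (ker_val c) + mpring_const n (eps k) *: dual_constF g /\
      qproj P g = phi c.

Section BilinTangent.
Context (k : fieldType) (n d1 d2 d3 r1 r2 : nat) (P : bilin k n d1 d2 d3 r1 r2).

(** [Pt] represents a tangent vector at [P], that is an element of
    [Bilin(k[eps])] restricting to the class of [P]. *)
Definition bilin_tangent (Pt : bilin (dualnum k) n d1 d2 d3 r1 r2) : Prop :=
  exists P0, bilin_base_change (@dual_ev k) Pt P0 /\ bilin_eq P0 P.

(** In the tangent space of [Quot * Quot * Quot], the image of [Pt] is the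
    vector identified with [(phi1, phi2, phi3)]. *)
Definition bilin_tangent_of
    (phi1 : {linear kernel (qproj (bquot1 P)) -> qmod (bquot1 P)})
    (phi2 : {linear kernel (qproj (bquot2 P)) -> qmod (bquot2 P)})
    (phi3 : {linear kernel (bproj3 P) -> bmod3 P})
    (Pt : bilin (dualnum k) n d1 d2 d3 r1 r2) : Prop :=
  [/\ quot_tangent_of (P := bquot1 P) phi1 (bquot1 Pt),
      quot_tangent_of (P := bquot2 P) phi2 (bquot2 Pt)
    & quot_tangent_of (P := bquot3 P) phi3 (bquot3 Pt)].

(** The tangent space at [P] as a subset of [Hom(K_1, M_1) * Hom(K_2, M_2) *
    Hom(K_3, M_3)]. *)
Definition bilin_tangent_hom
    (phi1 : {linear kernel (qproj (bquot1 P)) -> qmod (bquot1 P)})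
    (phi2 : {linear kernel (qproj (bquot2 P)) -> qmod (bquot2 P)})
    (phi3 : {linear kernel (bproj3 P) -> bmod3 P}) : Prop :=
  exists2 Pt, bilin_tangent Pt & bilin_tangent_of phi1 phi2 phi3 Pt.

End BilinTangent.

(* Main.v *)
Require Import Defs.
Set Warnings "-notation-overridden,-ambiguous-paths,-notation-incompatible-prefix,-redundant-canonical-projection".
From HB Require Import structures.
From mathcomp Require Import all_boot all_order all_algebra.
From mathcomp Require Import generic_quotient ring_quotient boolp.
From mathcomp Require Import mpoly ring.

Set Implicit Arguments.
Unset Strict Implicit.
Unset Printing Implicit Defensive.
Import GRing.Theory.
Local Open Scope ring_scope.

(** Write [S' = S[eps]] and [F' = F[eps]]. A tangent vector to [Quot] at
    [F/K] is a submodule [K'] of [F'] with locally free quotient [M'] restricting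
    to [F/K]. In such a quotient the elements killed by [eps], the elements of [eps M'] and the
    elements vanishing in [M] are the same ([ker_eps], [ker_base_change]).
    Hence every [c] in [K] lifts to some [c + eps g] in [K'], the class of [g]
    modulo [K] is determined by [c], and [phi c := g + K] is the homomorphism
    attached to [K'] ([quot_tangent_exists], [quot_tangent_uniq]). Conversely,
    for any [phi] the submodule [{c + eps g | g + K = phi c}] has a quotient
    that is free of the right rank over the dual numbers and restricts to [F/K]
    ([deformed_locally_free], [deformed_base_change]).

    Three deformations [K'_1, K'_2, K'_3] come from a bilinear map exactly when
    [x ⊗ y] lies in [K'_3] as soon as [x] is in [K'_1] or [y] is in [K'_2]; this
    is the criterion of [tens_factor] for [F'_1 ⊗ F'_2 -> F'_3 / K'_3] to
    descend to [M'_1 ⊗ M'_2]. Expanding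
    [(c + eps g) ⊗ (y + eps y') = c ⊗ y + eps (g ⊗ y + c ⊗ y')] ([kron_dual])
    and using that [c ⊗ y'] dies in [M_3], membership in [K'_3] says that
    [phi3 (c ⊗ y)] is the class of [g ⊗ y], which is [phi1 c ⊗ y]. This is the
    first equation, and the second one is symmetric ([bilin_tangent_of_eqs],
    [bilin_tangent_hom_of_eqs]).

    Elements of a module over the dual numbers are handled through their
    decomposition [x + eps y] with [x] and [y] over [k]; computations that use
    only [eps * eps = 0] are stated over an arbitrary commutative ring, with an
    element of square zero. *)

(** * Quotient modules and descent along surjections *)

Section QuotientModule.
Local Open Scope quotient_scope.
Context (R : comNzRingType) (V : lmodType R) (K : V -> Prop).
Context (K0 : K 0) (KP : forall a x y, K x -> K y -> K (a *: x + y)).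

Definition subm_pred : {pred V} := fun x => `[< K x >].

Fact subm_zmod_closed : zmod_closed subm_pred.
Proof.
split=> [|x y]; first exact/asboolP.
move=> /asboolP Kx /asboolP Ky; apply/asboolP.
by rewrite addrC -scaleN1r; apply: KP.
Qed.
HB.instance Definition _ := GRing.isZmodClosed.Build V subm_pred
  subm_zmod_closed.

Definition qmodule := Quotient.quot subm_pred.
HB.instance Definition _ := GRing.Zmodule.on qmodule.
HB.instance Definition _ := EqQuotient.on qmodule.

Definition qclass (x : V) : qmodule := \pi_qmodule x.

Lemma qclassD : {morph qclass : x y / x + y}.
Proof. by move=> x y; rewrite [LHS](raddfD \pi_(Quotient.quot subm_pred)). Qed.

Lemma qclass_eqE x y : qclass x = qclass y <-> K (x - y).
Proof.
split=> [/eqP|xy]; first by rewrite -Quotient.idealrBE => /asboolP.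
by apply/eqP; rewrite -Quotient.idealrBE; apply/asboolP.
Qed.

Lemma qclassK (t : qmodule) : qclass (repr t) = t.
Proof. exact: reprK. Qed.

Definition qscale (a : R) (t : qmodule) : qmodule := qclass (a *: repr t).

Lemma qclassZ a x : qscale a (qclass x) = qclass (a *: x).
Proof.
apply/qclass_eqE; rewrite -scalerBr -[_ *: _]addr0.
by apply: KP K0; apply/qclass_eqE/qclassK.
Qed.

Fact qscaleA a b t : qscale a (qscale b t) = qscale (a * b) t.
Proof. by rewrite -[t]qclassK !qclassZ scalerA. Qed.
Fact qscale1 : left_id 1 qscale.
Proof. by move=> t; rewrite -[t]qclassK qclassZ scale1r. Qed.
Fact qscaleDr : right_distributive qscale +%R.
Proof.
move=> a t u; rewrite -[t]qclassK -[u]qclassK.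
by rewrite -qclassD !qclassZ -qclassD scalerDr.
Qed.
Fact qscaleDl t : {morph qscale^~ t : a b / a + b}.
Proof. by move=> a b; rewrite -[t]qclassK !qclassZ -qclassD scalerDl. Qed.
HB.instance Definition _ := GRing.Zmodule_isLmodule.Build R qmodule
  qscaleA qscale1 qscaleDr qscaleDl.

Fact qclass_linear : linear qclass.
Proof. by move=> a x y; rewrite qclassD -qclassZ. Qed.
HB.instance Definition _ := GRing.isLinear.Build R V qmodule *:%R qclass
  qclass_linear.

Lemma quotient_module : exists (M : lmodType R) (q : {linear V -> M}),
  (forall y, exists x, q x = y) /\ (forall x, q x = 0 <-> K x).
Proof.
exists qmodule, qclass; split=> [y|x].
  by exists (repr y); apply: qclassK.
by rewrite -(linear0 qclass) -{2}[x]subr0; apply: qclass_eqE.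
Qed.

End QuotientModule.

(** The target may carry another scalar action [s], so that the lemma also
    yields the semilinear maps of a base change. *)
Lemma linear_factor (R : nzRingType) (V W : lmodType R) (N : zmodType)
    (s : GRing.Scale.law R N) (q : {linear V -> W}) (h : {linear V -> N | s}) :
    (forall y, exists x, q x = y) -> (forall x, q x = 0 -> h x = 0) ->
  exists w : {linear W -> N | s}, forall x, w (q x) = h x.
Proof.
move=> /choice[l ql] qh.
have hl x : h (l (q x)) = h x.
  by apply/eqP; rewrite -subr_eq0 -linearB qh // linearB /= ql subrr.
have wlin : linear_for s (h \o l).
  by move=> a x y; rewrite /= -{1}[x]ql -{1}[y]ql -(linearP q) hl linearP.
exists (HB.pack_for {linear W -> N | s} (h \o l)
  (GRing.isLinear.Build R W N s (h \o l) wlin)).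
exact: hl.
Qed.

(** The two vanishing conditions give the kernel of [q1 ⊗ q2] by right
    exactness; with sections of [q1] and [q2] the bilinear map is obtained
    without computing that kernel. *)
Lemma tens_factor (R : comNzRingType) (V1 V2 W1 W2 N : lmodType R)
    (q1 : {linear V1 -> W1}) (q2 : {linear V2 -> W2})
    (h : {linear tens V1 V2 -> N}) :
    (forall y, exists x, q1 x = y) -> (forall y, exists x, q2 x = y) ->
    (forall x y, q1 x = 0 -> h (x ⊗ y) = 0) ->
    (forall x y, q2 y = 0 -> h (x ⊗ y) = 0) ->
  exists w : {linear tens W1 W2 -> N}, forall t, w (tens_map q1 q2 t) = h t.
Proof.
move=> /choice[s1 qs1] /choice[s2 qs2] h1 h2.
have pureBl x x' (y : V2) : h (x ⊗ y) - h (x' ⊗ y) = h ((x - x') ⊗ y).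
  by rewrite -linearB -scaleN1r -pureZl -pureDl scaleN1r.
have pureBr (x : V1) y y' : h (x ⊗ y) - h (x ⊗ y') = h (x ⊗ (y - y')).
  by rewrite -linearB -scaleN1r -pureZr -pureDr scaleN1r.
have hs1 x y : h (s1 (q1 x) ⊗ y) = h (x ⊗ y).
  by apply/eqP; rewrite -subr_eq0 pureBl h1 // linearB /= qs1 subrr.
have hs2 x y : h (x ⊗ s2 (q2 y)) = h (x ⊗ y).
  by apply/eqP; rewrite -subr_eq0 pureBr h2 // linearB /= qs2 subrr.
pose b u v := h (s1 u ⊗ s2 v).
have bl v : linear (b^~ v).
  move=> a u u'; rewrite /b -{1}[u]qs1 -{1}[u']qs1 -linearP hs1.
  by rewrite pureDl pureZl linearP.
have br u : linear (b u).
  move=> a v v'; rewrite /b -{1}[v]qs2 -{1}[v']qs2 -linearP hs2.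
  by rewrite pureDr pureZr linearP.
exists (tens_lift bl br).
apply: (@tens_lin_ext _ _ _ _ (tens_lift bl br \o tens_map q1 q2) h) => x y.
by rewrite /comp /= tens_map_pure tens_lift_pure /b hs1 hs2.
Qed.

(** * Polynomials and rows over the dual numbers *)

Section DualPolynomials.
Context (k : fieldType) (n : nat).
Local Notation D := (dualnum k).
Local Notation cst := (mpring_map n (@dual_const k)).
Local Notation ev := (mpring_map n (@dual_ev k)).
Local Notation E := (mpring_const n (eps k)).

(* The lemmas about coefficients see through [mpring] in their proofs only, so
   that their statements use the same instances as the rest of the file. *)
Lemma mpring_map_const (A B : comNzRingType) (f : {rmorphism A -> B}) a :
  mpring_map n f (mpring_const n a) = mpring_const n (f a).
Proof.
#[local] Transparent mpring mpring_map mpring_const.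
exact: map_mpolyC.
Qed.
#[local] Opaque mpring mpring_map mpring_const.

Lemma ev_cst (p : mpring k n) : ev (cst p) = p.
Proof.
#[local] Transparent mpring mpring_map mpring_const.
by apply/mpolyP => m; rewrite !mcoeff_map_mpoly; apply: dual_ev_const.
Qed.
#[local] Opaque mpring mpring_map mpring_const.

Fact eps_coef_zmod_morphism : zmod_morphism (fun z : D => (z : {poly k})`_1).
Proof. by move=> x y; rewrite coefB. Qed.

Lemma mpring_decomp (p : mpring D n) : exists q, p = cst (ev p) + E * cst q.
Proof.
#[local] Transparent mpring mpring_map mpring_const.
pose f : {additive D -> k} := HB.pack_for {additive D -> k}
  (fun z : D => (z : {poly k})`_1)
  (GRing.isZmodMorphism.Build _ _ _ eps_coef_zmod_morphism).
exists (map_mpoly f p); apply/mpolyP => m.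
have /= fE := mcoeff_map_mpoly f m p.
rewrite mcoeffD [X in _ + X](mcoeffCM (eps k)).
rewrite [LHS]dual_decomp; congr (_ + _ * _).
  by rewrite [RHS]mcoeff_map_mpoly [in RHS]mcoeff_map_mpoly.
by rewrite [RHS]mcoeff_map_mpoly fE.
Qed.
#[local] Opaque mpring mpring_map mpring_const.

Lemma cst_eps_inj (q : mpring k n) : E * cst q = 0 -> q = 0.
Proof.
#[local] Transparent mpring mpring_map mpring_const.
move=> Eq0; apply/mpolyP => m; rewrite mcoeff0.
move/(congr1 (fun p : {mpoly D[n]} => (p@_m : {poly k})`_1)): Eq0.
rewrite mcoeff0 (mcoeffCM (eps k)) (mcoeff_map_mpoly (@dual_const k)).
rewrite dual_coefM !eps_coef mul0r add0r mul1r.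
by rewrite coefC coef0 => <-.
Qed.
#[local] Opaque mpring mpring_map mpring_const.

Lemma eps_sqr : E * E = 0.
Proof. by rewrite -rmorphM /= eps_sq rmorph0. Qed.

Lemma ev_eps : ev E = 0.
Proof. by rewrite mpring_map_const dual_ev_eps rmorph0. Qed.
End DualPolynomials.

Lemma dual_scaleE (R : comNzRingType) (V : lmodType R) (e a b : R) (x y : V) :
  e * e = 0 ->
  (a + e * b) *: (x + e *: y) = a *: x + e *: (a *: y + b *: x).
Proof.
move=> e2; rewrite !scalerDl !scalerDr !scalerA mulrAC e2 mul0r scale0r addr0.
by rewrite [e * a]mulrC addrA.
Qed.

Section DualRow.
Context (k : fieldType) (n r : nat).
Local Notation cst := (mpring_map n (@dual_const k)).
Local Notation ev := (mpring_map n (@dual_ev k)).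
Local Notation E := (mpring_const n (eps k)).
Local Notation dcF := (@dual_constF k n r).

Lemma dual_constFP a x y : dcF (a *: x + y) = cst a *: dcF x + dcF y.
Proof. by rewrite /dual_constF map_mxD map_mxZ. Qed.

Lemma dual_constFD x y : dcF (x + y) = dcF x + dcF y.
Proof. exact: map_mxD. Qed.

Lemma dual_constFB x y : dcF (x - y) = dcF x - dcF y.
Proof. exact: map_mxB. Qed.

Lemma dual_constFZ a x : dcF (a *: x) = cst a *: dcF x.
Proof. exact: map_mxZ. Qed.

Lemma dual_constF0 : dcF 0 = 0.
Proof. exact: map_mx0. Qed.

Lemma ev_dual_constF x : map_mx ev (dcF x) = x.
Proof. by apply/rowP => i; rewrite !mxE ev_cst. Qed.

Lemma ev_eps_row (x : 'rV[mpring (dualnum k) n]_r) : map_mx ev (E *: x) = 0.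
Proof. by rewrite map_mxZ ev_eps scale0r. Qed.

Lemma ev_dual_row x y : map_mx ev (dcF x + E *: dcF y) = x.
Proof. by rewrite map_mxD ev_eps_row addr0 ev_dual_constF. Qed.

Lemma dual_rowD x x' y y' :
  dcF x + E *: dcF y + (dcF x' + E *: dcF y') = dcF (x + x') + E *: dcF (y + y').
Proof. by rewrite !dual_constFD [E *: (_ + _)]scalerDr; exact: addrACA. Qed.

Lemma dual_rowZ a b x y :
  (cst a + E * cst b) *: (dcF x + E *: dcF y)
    = dcF (a *: x) + E *: dcF (a *: y + b *: x).
Proof.
rewrite dual_constFD !dual_constFZ.
exact: dual_scaleE (eps_sqr k n).
Qed.

Lemma dual_rowP a x x' y y' :
  dcF (a *: x + x') + E *: dcF (a *: y + y')
    = cst a *: (dcF x + E *: dcF y) + (dcF x' + E *: dcF y').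
Proof.
rewrite !dual_constFP !scalerDr [E *: (_ *: _)]scalerA [E * _]mulrC -scalerA.
exact: addrACA.
Qed.

Lemma mpring_const_row a b x :
  mpring_const n (dual_const k a + eps k * dual_const k b) *: dcF x
    = dcF (mpring_const n a *: x) + E *: dcF (mpring_const n b *: x).
Proof.
rewrite rmorphD rmorphM -(mpring_map_const n _ a) -(mpring_map_const n _ b).
rewrite (dual_constFZ (mpring_const n a)) (dual_constFZ (mpring_const n b)).
rewrite [X in _ = _ + X]scalerA.
exact: scalerDl.
Qed.

Lemma dual_constF_sum I (s : seq I) (p : pred I) (f : I -> 'rV[mpring k n]_r) :
  dcF (\sum_(i <- s | p i) f i) = \sum_(i <- s | p i) dcF (f i).
Proof. exact: (big_morph dcF dual_constFD dual_constF0). Qed.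

Lemma dual_row_decomp x : exists y, x = dcF (map_mx ev x) + E *: dcF y.
Proof.
have [y xE] := choice (fun i => mpring_decomp (x 0 i)).
by exists (\row_i y i); apply/rowP => i; rewrite !mxE.
Qed.

Lemma dual_row_inj x0 x1 y0 y1 :
  dcF x0 + E *: dcF x1 = dcF y0 + E *: dcF y1 -> x0 = y0 /\ x1 = y1.
Proof.
move=> xy; have x0y0 : x0 = y0.
  by rewrite -(ev_dual_row x0 x1) xy ev_dual_row.
split; first exact: x0y0.
move: xy; rewrite x0y0 => /addrI /eqP.
rewrite -subr_eq0 -scalerBr -dual_constFB => /eqP xy0.
apply/eqP; rewrite -subr_eq0; apply/eqP/rowP => i; rewrite [RHS]mxE.
by apply: cst_eps_inj; move/rowP/(_ i): xy0; rewrite !mxE.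
Qed.

Lemma epsZZ (x : 'rV[mpring (dualnum k) n]_r) : E *: (E *: x) = 0.
Proof. by rewrite scalerA eps_sqr scale0r. Qed.

End DualRow.

(** * Bases of locally free modules over a local ring *)

Definition is_basis (A : comNzRingType) (n d : nat) (M : lmodType (mpring A n))
    (e : 'I_d -> M) : Prop :=
  (forall m, exists c : 'I_d -> A, m = \sum_(i < d) mpring_const n (c i) *: e i) /\
  (forall c : 'I_d -> A, \sum_(i < d) mpring_const n (c i) *: e i = 0 ->
      forall i, c i = 0).

Lemma is_basis_locally_free (A : comNzRingType) (n d : nat)
    (M : lmodType (mpring A n)) (e : 'I_d -> M) :
  is_basis e -> locally_free d M.
Proof.
move=> [span_e free_e]; exists 1%N, (fun=> 1); split.
  by exists (fun=> 1); rewrite big_ord1 mulr1.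
move=> _; exists e; split=> [m|c /free_e c0].
  have [c mE] := span_e m; exists 0%N, c.
  by rewrite expr0 rmorph1 scale1r.
by exists 0%N => i; rewrite c0 mulr0.
Qed.

(** Elements outside the kernel of [f] are units, so [A] is a local ring: one
    member of any cover of its spectrum by principal open subsets is the whole
    spectrum. *)
Lemma locally_free_basis (A : comNzRingType) (k : fieldType)
    (f : {rmorphism A -> k}) (n d : nat) (M : lmodType (mpring A n)) :
    (forall a, f a != 0 -> exists b, b * a = 1) ->
  locally_free d M -> exists e : 'I_d -> M, is_basis e.
Proof.
move=> f_local [m [a [[b ba1] basis_a]]].
have [i fai]: exists i, f (a i) != 0.
  apply: contrapT => noi; have: f 1 = 0.
    rewrite -ba1 rmorph_sum big1 // => i _; rewrite rmorphM /=.
    have [->|fai] := eqVneq (f (a i)) 0; first by rewrite mulr0.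
    by case: noi; exists i.
  by rewrite rmorph1 => /eqP; rewrite oner_eq0.
have [a' a'a] := f_local _ fai.
have a'aN N : a' ^+ N * a i ^+ N = 1 by rewrite -exprMn a'a expr1n.
have [e [span_e free_e]] := basis_a i; exists e; split=> [x|c /free_e[N cN0] j].
  have [N [c xE]] := span_e x; exists (fun j => a' ^+ N * c j).
  rewrite -[LHS]scale1r -(rmorph1 (mpring_const n)) -(a'aN N) rmorphM -scalerA.
  by rewrite xE scaler_sumr; apply: eq_bigr => j _; rewrite rmorphM scalerA.
by rewrite -[LHS]mul1r -(a'aN N) -mulrA cN0 mulr0.
Qed.

(** The matrices expressing [e] in [f] and [f] in [e] are square, so they are
    inverse to each other on both sides as soon as they are on one. *)
Lemma spanning_is_basis (A : comNzRingType) (n d : nat)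
    (M : lmodType (mpring A n)) (e f : 'I_d -> M) :
    is_basis e ->
    (forall m, exists c : 'I_d -> A, m = \sum_(i < d) mpring_const n (c i) *: f i) ->
  is_basis f.
Proof.
move=> [span_e free_e] span_f; split=> // c cf0.
have [a eE] := choice (fun i => span_f (e i)).
have [b fE] := choice (fun i => span_e (f i)).
pose comb (v : 'rV[A]_d) (g : 'I_d -> M) :=
  \sum_(i < d) mpring_const n (v 0 i) *: g i.
have comb_mul (v : 'rV[A]_d) (B : 'M[A]_d) (g h : 'I_d -> M) :
    (forall i, h i = comb (row i B) g) -> comb v h = comb (v *m B) g.
  move=> hE; rewrite /comb; under eq_bigr => i _ do rewrite hE scaler_sumr.
  rewrite exchange_big; apply: eq_bigr => j _ /=.
  rewrite mxE rmorph_sum scaler_suml; apply: eq_bigr => i _.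
  by rewrite scalerA rmorphM !mxE.
have free_row v : comb v e = 0 -> v = 0.
  by move=> /free_e v0; apply/rowP => i; rewrite v0 mxE.
pose B := \matrix_(i, j) b i j; pose C := \matrix_(i, j) a i j.
have fB i : f i = comb (row i B) e.
  by rewrite [LHS]fE; apply: eq_bigr => j _; rewrite !mxE.
have eC i : e i = comb (row i C) f.
  by rewrite [LHS]eE; apply: eq_bigr => j _; rewrite !mxE.
have combB g v w : comb (v - w) g = comb v g - comb w g.
  by rewrite /comb -sumrB; apply: eq_bigr => i _; rewrite !mxE rmorphB scalerBl.
have CB : C *m B = 1%:M.
  apply/row_matrixP => i; rewrite row_mul -[LHS](subrK (row i 1%:M)).
  rewrite [X in X + _]free_row ?add0r // combB -(comb_mul _ _ _ _ fB) -eC.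
  rewrite /comb (bigD1 i) //= big1 ?addr0 => [|j /negPf nji]; last first.
    by rewrite !mxE eq_sym nji rmorph0 scale0r.
  by rewrite !mxE eqxx rmorph1 scale1r subrr.
pose v := \row_i c i.
have v0 : v = 0.
  rewrite -[v]mulmx1 -(mulmx1C CB) mulmxA [v *m B]free_row ?mul0mx //.
  rewrite -(comb_mul _ _ _ _ fB) -[RHS]cf0.
  by apply: eq_bigr => i _; rewrite mxE.
by move=> i; move/rowP/(_ i): v0; rewrite !mxE.
Qed.

Lemma field_local (k : fieldType) (a : k) : idfun a != 0 -> exists b, b * a = 1.
Proof. by move=> a0; exists a^-1; rewrite mulVf. Qed.

(** The inverse of [b + eps c] is [b^-2 (b - eps c)]. *)
Lemma dual_local (k : fieldType) (z : dualnum k) :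
  dual_ev k z != 0 -> exists w, w * z = 1.
Proof.
rewrite -[dual_ev k z]/(z`_0) => z0.
exists (@dual_const k (z`_0 ^-2) * (dual_const k z`_0 - eps k * dual_const k z`_1)).
have E2 := eps_sq k.
rewrite [X in _ * X]dual_decomp -mulrA.
set a := dual_const k _; set b := dual_const k _ in E2 *; set c := dual_const k _.
have -> : (b - eps k * c) * (b + eps k * c) = b * b - eps k * eps k * (c * c).
  by ring.
by rewrite E2 mul0r subr0 -!rmorphM -expr2 mulVf ?expf_neq0 ?rmorph1.
Qed.

(** Flatness over the dual numbers, read off a basis. *)
Lemma ker_eps (k : fieldType) (n d : nat)
    (M : lmodType (mpring (dualnum k) n)) (m : M) :
    locally_free d M -> mpring_const n (eps k) *: m = 0 ->
  exists m', m = mpring_const n (eps k) *: m'.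
Proof.
move=> /(locally_free_basis (@dual_local k))[e [span_e free_e]].
have [c ->] := span_e m; rewrite scaler_sumr => Em0.
exists (\sum_(i < d) mpring_const n (dual_const k (c i)`_1) *: e i).
rewrite scaler_sumr; apply: eq_bigr => i _; rewrite scalerA -rmorphM /=.
have /free_e/(_ i)/(congr1 (fun z : dualnum k => z`_1)) :
    \sum_(i < d) mpring_const n (eps k * c i) *: e i = 0.
  by rewrite -[RHS]Em0; apply: eq_bigr => j _; rewrite scalerA rmorphM.
rewrite dual_coefM !eps_coef mul0r add0r mul1r coef0 => ci0.
by rewrite {1}[c i]dual_decomp ci0 rmorph0 add0r.
Qed.

(** A basis of [M'] maps to a spanning family of [M] of cardinality [d], hence to
    a basis, so an element of [M'] vanishing in [M] has all its coordinates
    in [eps k]. *)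
Lemma ker_base_change (k : fieldType) (n d : nat)
    (M' : lmodType (mpring (dualnum k) n)) (M : lmodType (mpring k n))
    (u : {linear M' -> M | mpring_map n (@dual_ev k) \; *:%R}) :
    locally_free d M' -> locally_free d M -> (forall y, exists x, u x = y) ->
  forall m, u m = 0 -> exists m', m = mpring_const n (eps k) *: m'.
Proof.
move=> /(locally_free_basis (@dual_local k))[e' [span' _]].
move=> /(locally_free_basis (@field_local k))[e basis_e] u_surj m.
have uE (c : 'I_d -> dualnum k) :
    u (\sum_(i < d) mpring_const n (c i) *: e' i)
      = \sum_(i < d) mpring_const n (dual_ev k (c i)) *: u (e' i).
  rewrite linear_sum; apply: eq_bigr => i _.
  by rewrite linearZ /= mpring_map_const.
have [_ free_ue] : is_basis (fun i => u (e' i)).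
  apply: (spanning_is_basis basis_e) => y; have [x <-] := u_surj y.
  by have [c ->] := span' x; exists (fun i => dual_ev k (c i)); rewrite uE.
have [c ->] := span' m; rewrite uE => /free_ue c0.
exists (\sum_(i < d) mpring_const n (dual_const k (c i)`_1) *: e' i).
rewrite scaler_sumr; apply: eq_bigr => i _; rewrite scalerA -rmorphM /=.
by rewrite {1}[c i]dual_decomp -[(c i)`_0]/(dual_ev k (c i)) c0 rmorph0 add0r.
Qed.

(** * First-order deformations of a quotient of a free module *)

Section QuotTangent.
Context (k : fieldType) (n d r : nat) (Q : quot k n d r).
Local Notation cst := (mpring_map n (@dual_const k)).
Local Notation ev := (mpring_map n (@dual_ev k)).
Local Notation E := (mpring_const n (eps k)).
Local Notation dcF := (@dual_constF k n r).
Local Notation q := (qproj Q).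

Section DeformedKernel.
Context (phi : {linear kernel q -> qmod Q}).

(** The submodule attached to [phi]; [quot_tangent_of phi Qt] says that it is the
    kernel of [Qt]. *)
Definition deformed_ker (z : 'rV[mpring (dualnum k) n]_r) : Prop :=
  exists (c : kernel q) (g : 'rV[mpring k n]_r),
    z = dcF (ker_val c) + E *: dcF g /\ q g = phi c.

Lemma deformed_kerE x y :
  deformed_ker (dcF x + E *: dcF y) <-> exists c, ker_val c = x /\ q y = phi c.
Proof.
split=> [[c [g [xyE gE]]]|[c [<- yE]]].
  have [-> ->] := dual_row_inj xyE; exists c; split; [reflexivity | exact: gE].
exists c, y; split; [reflexivity | exact: yE].
Qed.

Lemma deformed_ker0 : deformed_ker 0.
Proof.
exists 0, 0; split; last by rewrite !linear0.
by rewrite (linear0 (@ker_val _ _ _ q)) dual_constF0 scaler0 addr0.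
Qed.

(** Multiplying [c + eps g] by [a0 + eps a1] adds [a1 c] to the [eps] part, which
    is harmless as [c] is in the kernel of [q]. *)
Lemma deformed_kerP a x y :
  deformed_ker x -> deformed_ker y -> deformed_ker (a *: x + y).
Proof.
move=> [c [g [-> gE]]] [c' [g' [-> gE']]]; have [a1 ->] := mpring_decomp a.
set a0 := ev a.
exists (a0 *: c + c'), (a0 *: g + a1 *: ker_val c + g'); split.
  by rewrite dual_rowZ dual_rowD.
rewrite linearD linearP [q (_ *: ker_val c)]linearZ /= ker_valP scaler0 addr0.
by rewrite gE gE' linearP.
Qed.

Lemma quot_tangent_ofE Qt x y : quot_tangent_of phi Qt ->
  qproj Qt (dcF x + E *: dcF y) = 0 <-> exists c, ker_val c = x /\ q y = phi c.
Proof. by move=> tphi; apply: iff_trans (tphi _) (deformed_kerE _ _). Qed.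

(** The classes in [M'] of lifts to [F] of a basis of [F/K] form a basis. Modulo
    the deformed kernel, any [z0 + eps z1] differs from a combination of the
    lifts by an element of [eps F], and [eps F] maps onto a copy of [F/K]. *)
Lemma deformed_locally_free (M' : lmodType (mpring (dualnum k) n))
    (qt : {linear 'rV[mpring (dualnum k) n]_r -> M'}) :
    (forall y, exists x, qt x = y) -> (forall x, qt x = 0 <-> deformed_ker x) ->
  locally_free d M'.
Proof.
move=> qt_surj qtE.
have [e [span_e free_e]] := locally_free_basis (@field_local k) (qmod_rank Q).
have [x xE] := choice (fun i => qproj_surj (e i)).
pose comb (c : 'I_d -> k) := \sum_(i < d) mpring_const n (c i) *: x i.
have q_comb c : q (comb c) = \sum_(i < d) mpring_const n (c i) *: e i.
  by rewrite linear_sum; apply: eq_bigr => i _; rewrite linearZ /= xE.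
pose et i := qt (dcF (x i)).
have qt_comb (a b : 'I_d -> k) :
    \sum_(i < d) mpring_const n (dual_const k (a i) + eps k * dual_const k (b i)) *: et i
      = qt (dcF (comb a) + E *: dcF (comb b)).
  rewrite !dual_constF_sum scaler_sumr -big_split linear_sum.
  by apply: eq_bigr => i _; rewrite /= -mpring_const_row linearZ.
apply: (@is_basis_locally_free _ _ _ _ et); split=> [m|c].
  have [z <-] := qt_surj m; have [z1 zE] := dual_row_decomp z.
  set z0 := map_mx ev z in zE.
  have [a z0E] := span_e (q z0); rewrite -q_comb in z0E.
  have ker0 : z0 - comb a \in ker_pred q.
    by apply/eqP; rewrite linearB /= z0E subrr.
  (* trading [z0 - comb a] for [- eps g] in the quotient *)
  have [g gE] := qproj_surj (phi (Kernel ker0)).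
  have [b z1E] := span_e (q (z1 - g)); rewrite -q_comb in z1E.
  exists (fun i => dual_const k (a i) + eps k * dual_const k (b i)).
  rewrite qt_comb zE; apply/eqP; rewrite -subr_eq0 -linearB; apply/eqP/qtE.
  exists (Kernel ker0), (z1 - comb b); split.
    by rewrite [ker_val _]/= !dual_constFB scalerBr opprD addrACA.
  by rewrite linearB /= -z1E linearB /= opprB addrC subrK.
have [a [b cE]] : exists a b : 'I_d -> k,
    forall i, c i = dual_const k (a i) + eps k * dual_const k (b i).
  by exists (fun i => (c i)`_0), (fun i => (c i)`_1) => i; apply: dual_decomp.
rewrite (eq_bigr _ (fun i _ => congr1 (fun t => mpring_const n t *: et i) (cE i))).
rewrite qt_comb => /qtE/deformed_kerE[kc [kcE qE]].
have a0 : forall i, a i = 0.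
  by apply: free_e; rewrite -q_comb -kcE ker_valP.
have kc0 : kc = 0.
  apply: val_inj; rewrite [LHS]kcE /comb big1 // => i _.
  by rewrite a0 rmorph0 scale0r.
have b0 : forall i, b i = 0.
  by apply: free_e; rewrite -q_comb qE kc0 linear0.
by move=> i; rewrite cE a0 b0 !rmorph0 mulr0 addr0.
Qed.

(** A semilinear map [v] out of [M'] kills [eps M'], hence depends only on the
    values of [v \o qt \o dcF], a linear map over the base ring; it kills [K]
    because every [x] in [K] is congruent to an element of [eps F]. *)
Lemma deformed_base_change (M' : lmodType (mpring (dualnum k) n))
    (qt : {linear 'rV[mpring (dualnum k) n]_r -> M'}) :
    (forall y, exists x, qt x = y) -> (forall x, qt x = 0 <-> deformed_ker x) ->
  exists u : {linear M' -> qmod Q | ev \; *:%R},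
    is_base_change u /\ forall x, u (qt x) = q (map_mx ev x).
Proof.
move=> qt_surj qtE.
pose h x := q (map_mx ev x).
have h_lin : linear_for (ev \; *:%R) h.
  by move=> a x y; rewrite /h map_mxD map_mxZ linearP.
pose hL := HB.pack_for {linear 'rV[mpring (dualnum k) n]_r -> qmod Q | ev \; *:%R} h
  (GRing.isLinear.Build _ _ _ _ h h_lin).
have h0 x : qt x = 0 -> hL x = 0.
  move=> /qtE[c [g [-> _]]]; rewrite -[LHS]/(h _) /h ev_dual_row.
  exact: ker_valP.
have [u uE] := linear_factor (h := hL) qt_surj h0.
exists u; split; last exact: uE.
move=> N v.
pose w x := v (qt (dcF x)).
have wE z : w (map_mx ev z) = v (qt z).
  have [z1 {2}->] := dual_row_decomp z.
  by rewrite !linearD [in RHS]linearZ [X in _ + X]linearZ /= ev_eps scale0r addr0.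
have w_lin : linear w.
  by move=> a x y; rewrite /w dual_constFP linearP linearP /= ev_cst.
pose wL := HB.pack_for {linear 'rV[mpring k n]_r -> N} w
  (GRing.isLinear.Build _ _ _ _ w w_lin).
have w0 x : q x = 0 -> wL x = 0.
  move=> x0; rewrite -[LHS]/(w _).
  have x_ker : x \in ker_pred q by apply/eqP.
  have [g gE] := qproj_surj (phi (Kernel x_ker)).
  rewrite -(ev_dual_row x g) wE -(linear0 v); congr (v _); apply/qtE.
  exists (Kernel x_ker), g; split; [reflexivity | exact: gE].
have [w' w'E] := linear_factor (h := wL) (@qproj_surj _ _ _ _ Q) w0.
exists w'; split=> [m|w'' w''E y].
  by have [z <-] := qt_surj m; rewrite uE [LHS]w'E [LHS]wE.
have [x <-] := qproj_surj y.
by rewrite w'E -{1}(ev_dual_constF x) -[q (map_mx _ _)]/(hL _) -uE w''E.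
Qed.

End DeformedKernel.

Lemma quot_tangent_uniq (phi psi : {linear kernel q -> qmod Q}) Qt :
  quot_tangent_of phi Qt -> quot_tangent_of psi Qt -> psi =1 phi.
Proof.
move=> tphi tpsi c; have [g gE] := qproj_surj (phi c).
have /(quot_tangent_ofE _ _ tphi)/(quot_tangent_ofE _ _ tpsi)[c' [cc' gE']] :
    exists c', ker_val c' = ker_val c /\ q g = phi c'.
  exists c; split; [reflexivity | exact: gE].
by rewrite -gE gE'; congr (psi _); apply: val_inj.
Qed.

(** For [c] in [K] pick [l c] with [c + eps (l c)] in the kernel of [Qt]; two
    choices differ by an element of [K], since [eps g] is in that kernel
    exactly when [g] is in [K]. *)
Lemma quot_tangent_exists Qt (Q0 : quot k n d r)
    (u : {linear qmod Qt -> qmod Q0 | ev \; *:%R}) :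
    (forall x, u (qproj Qt x) = qproj Q0 (map_mx ev x)) -> quot_eq Q0 Q ->
  exists phi : {linear kernel q -> qmod Q}, quot_tangent_of phi Qt.
Proof.
move=> uE QQ; pose qt := qproj Qt.
have u_surj y : exists x, u x = y.
  have [x <-] := qproj_surj y; exists (qt (dcF x)).
  by rewrite uE ev_dual_constF.
have epsM m : exists g, E *: m = qt (E *: dcF g).
  have [z <-] := qproj_surj m; exists (map_mx ev z).
  have [z1 {1}->] := dual_row_decomp z.
  by rewrite -linearZ scalerDr epsZZ addr0.
have ker_u m : u m = 0 -> exists g, m = qt (E *: dcF g).
  move=> /(ker_base_change (qmod_rank Qt) (qmod_rank Q0) u_surj)[m' ->].
  exact: epsM.
have ker_base x y : qt (dcF x + E *: dcF y) = 0 -> q x = 0.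
  move=> xy0; apply/QQ; have := uE (dcF x + E *: dcF y).
  by rewrite xy0 linear0 ev_dual_row.
have ker_fiber g : qt (E *: dcF g) = 0 <-> q g = 0.
  split=> [Eg0|g0].
    apply/QQ; have := uE (dcF g); rewrite ev_dual_constF => <-.
    have [|m' ->] := @ker_eps _ _ _ _ (qt (dcF g)) (qmod_rank Qt).
      by rewrite -linearZ.
    by rewrite linearZ /= ev_eps scale0r.
  have [|h gE] := ker_u (qt (dcF g)); first by rewrite uE ev_dual_constF; apply/QQ.
  by rewrite linearZ /= [qt _]gE -linearZ epsZZ linear0.
have lift (c : kernel q) : exists g, qt (dcF (ker_val c) + E *: dcF g) = 0.
  have [|h cE] := ker_u (qt (dcF (ker_val c))).
    by rewrite uE ev_dual_constF; apply/QQ/ker_valP.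
  by exists (- h); rewrite -[- h]sub0r dual_constFB dual_constF0 sub0r scalerN
    linearB /= cE subrr.
have [l lE] := choice lift.
have ker_diff x y y' :
    qt (dcF x + E *: dcF y) = 0 -> qt (dcF x + E *: dcF y') = 0 <-> q y' = q y.
  move=> xy0; have -> : dcF x + E *: dcF y'
      = dcF x + E *: dcF y + E *: dcF (y' - y).
    by rewrite dual_constFB scalerBr -addrA [E *: dcF y + _]addrC subrK.
  rewrite linearD /= xy0 add0r; apply: iff_trans (ker_fiber _) _.
  by rewrite linearB; split=> [/eqP|->]; rewrite ?subrr // subr_eq0 => /eqP.
pose phi c := q (l c).
have phi_lin : linear phi.
  move=> a c c'; rewrite /phi -linearP; apply/esym/(ker_diff _ _ _ (lE _)).
  rewrite (linearP (@ker_val _ _ _ q)) dual_rowP linearP.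
  by rewrite [X in _ *: X]lE [X in _ + X]lE scaler0 addr0.
exists (HB.pack_for {linear kernel q -> qmod Q} phi
  (GRing.isLinear.Build _ _ _ *:%R phi phi_lin)) => x.
split=> [x0|[c [g [-> gE]]]]; last by apply/(ker_diff _ _ _ (lE c)).
have [x1 xE] := dual_row_decomp x; rewrite xE in x0.
have x_ker : map_mx ev x \in ker_pred q by apply/eqP/(ker_base _ _ x0).
exists (Kernel x_ker), x1; split; first exact: xE.
exact/(ker_diff _ _ _ (lE (Kernel x_ker))).
Qed.

End QuotTangent.

(** * Deformations of a bilinear map *)

Lemma map_kron (R R' : comNzRingType) (f : {rmorphism R -> R'}) (r1 r2 : nat)
    (x : 'rV[R]_r1) (y : 'rV[R]_r2) :
  map_mx f (kron (x ⊗ y)) = kron (map_mx f x ⊗ map_mx f y).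
Proof. by rewrite !kron_pure map_mxvec map_mxM map_trmx. Qed.

Lemma tens_map_comp_pure (R : comNzRingType) (M N M' N' M'' N'' : lmodType R)
    (f : {linear M -> M'}) (g : {linear N -> N'})
    (f' : {linear M' -> M''}) (g' : {linear N' -> N''}) x y :
  tens_map f' g' (tens_map f g (x ⊗ y)) = f' (f x) ⊗ g' (g y).
Proof. by rewrite (tens_map_pure f g) tens_map_pure. Qed.

Lemma pure_eps (R : comNzRingType) (V W : lmodType R) (e : R) (x x' : V) (y y' : W) :
  e * e = 0 ->
  (x + e *: x') ⊗ (y + e *: y') = x ⊗ y + e *: (x' ⊗ y + x ⊗ y').
Proof.
move=> e2; rewrite !pureDl !pureDr !pureZl !pureZr scalerA e2 scale0r addr0.
by rewrite scalerDr addrA addrAC.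
Qed.

Lemma kron_dual (k : fieldType) (n r1 r2 : nat) (x x' : 'rV[mpring k n]_r1)
    (y y' : 'rV[mpring k n]_r2) :
  kron ((dual_constF x + mpring_const n (eps k) *: dual_constF x')
        ⊗ (dual_constF y + mpring_const n (eps k) *: dual_constF y'))
    = dual_constF (kron (x ⊗ y))
      + mpring_const n (eps k) *: dual_constF (kron (x' ⊗ y) + kron (x ⊗ y')).
Proof.
rewrite dual_constFD /dual_constF !map_kron.
by rewrite (pure_eps _ _ _ _ (eps_sqr k n)) linearD linearZ linearD.
Qed.

Section BilinBaseChange.
Context (A B : comNzRingType) (f : {rmorphism A -> B}).
Context (n d1 d2 d3 r1 r2 : nat).
Context (P : bilin A n d1 d2 d3 r1 r2) (Q : bilin B n d1 d2 d3 r1 r2).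
Context (u1 : {linear qmod (bquot1 P) -> qmod (bquot1 Q) | mpring_map n f \; *:%R}).
Context (u2 : {linear qmod (bquot2 P) -> qmod (bquot2 Q) | mpring_map n f \; *:%R}).
Context (u3 : {linear bmod3 P -> bmod3 Q | mpring_map n f \; *:%R}).

(** The third quotient is built from the other data, so its compatibility with
    base change follows from that of the bilinear map. *)
Lemma bproj3_base_change :
    (forall x, u1 (qproj (bquot1 P) x) = qproj (bquot1 Q) (map_mx (mpring_map n f) x)) ->
    (forall x, u2 (qproj (bquot2 P) x) = qproj (bquot2 Q) (map_mx (mpring_map n f) x)) ->
    (forall x y, u3 (bpi P (x ⊗ y)) = bpi Q (u1 x ⊗ u2 y)) ->
  forall z, u3 (bproj3 P z) = bproj3 Q (map_mx (mpring_map n f) z).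
Proof.
move=> u1E u2E u3E z; rewrite -(unkronK z) bproj3_kron.
elim/tens_ind: (unkron z) => [x y||a t s tE sE].
- by rewrite tens_map_pure u3E u1E u2E map_kron bproj3_kron tens_map_pure.
- by rewrite !linear0 map_mx0 linear0.
rewrite (linearP kron) map_mxD map_mxZ (linearP (bproj3 Q)) -tE -sE.
by rewrite (linearP (tens_map _ _)) (linearP (bpi P)) linearP.
Qed.
End BilinBaseChange.

Section BilinTangentSpace.
Context (k : fieldType) (n d1 d2 d3 r1 r2 : nat) (P : bilin k n d1 d2 d3 r1 r2).
Local Notation M1 := (qmod (bquot1 P)).
Local Notation M2 := (qmod (bquot2 P)).
Local Notation M3 := (bmod3 P).
Local Notation p1 := (qproj (bquot1 P)).
Local Notation p2 := (qproj (bquot2 P)).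
Local Notation p3 := (bproj3 P).
Local Notation ev := (mpring_map n (@dual_ev k)).
Local Notation E := (mpring_const n (eps k)).
Local Notation dcF := (@dual_constF k n _).

Lemma bilin_tangent_exists (Pt : bilin (dualnum k) n d1 d2 d3 r1 r2) :
  bilin_tangent P Pt ->
  exists (phi1 : {linear kernel p1 -> M1}) (phi2 : {linear kernel p2 -> M2})
    (phi3 : {linear kernel p3 -> M3}), bilin_tangent_of phi1 phi2 phi3 Pt.
Proof.
move=> [P0 [[u1 [u2 [u3 [_ [u1E u2E u3E]]]]] [eq1 eq2 eq3]]].
have [phi1 tphi1] := quot_tangent_exists u1E eq1.
have [phi2 tphi2] := quot_tangent_exists u2E eq2.
have u3E' := bproj3_base_change u1E u2E u3E.
have [phi3 tphi3] := @quot_tangent_exists _ _ _ _ (bquot3 P) (bquot3 Pt) (bquot3 P0)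
  u3 u3E' eq3.
by exists phi1, phi2, phi3.
Qed.

Context (phi1 : {linear kernel p1 -> M1}) (phi2 : {linear kernel p2 -> M2}).
Context (phi3 : {linear kernel p3 -> M3}).

Lemma ker_val_incl1 k1 f2 : ker_val (incl1 P (k1 ⊗ f2)) = kron (ker_val k1 ⊗ f2).
Proof. by rewrite /incl1 /= tens_map_pure. Qed.

Lemma ker_val_incl2 f1 k2 : ker_val (incl2 P (f1 ⊗ k2)) = kron (f1 ⊗ ker_val k2).
Proof. by rewrite /incl2 /= tens_map_pure. Qed.

Definition bilin_tangent_eqs : Prop :=
  (forall k1 f2, phi3 (incl1 P (k1 ⊗ f2)) = bpi P (phi1 k1 ⊗ p2 f2)) /\
  (forall f1 k2, phi3 (incl2 P (f1 ⊗ k2)) = bpi P (p1 f1 ⊗ phi2 k2)).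

(** Evaluate the deformed bilinear map at [(k1 + eps g) ⊗ f2], whose first factor
    dies in the deformed [M_1] when [g] represents [phi1 k1]. *)
Lemma bilin_tangent_of_eqs (Pt : bilin (dualnum k) n d1 d2 d3 r1 r2) :
  bilin_tangent_of phi1 phi2 phi3 Pt -> bilin_tangent_eqs.
Proof.
move=> [t1 t2 t3]; split.
  move=> k1 f2; have [g gE] := qproj_surj (phi1 k1).
  have x0 : qproj (bquot1 Pt) (dcF (ker_val k1) + E *: dcF g) = 0.
    by apply/(quot_tangent_ofE _ _ t1); exists k1; split; [reflexivity | exact: gE].
  have := bproj3_kron Pt ((dcF (ker_val k1) + E *: dcF g) ⊗ (dcF f2 + E *: dcF 0)).
  rewrite tens_map_pure x0 pure0l linear0 kron_dual pure0r linear0 addr0.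
  move=> /(quot_tangent_ofE _ _ t3) [c [cE]].
  rewrite [LHS]bproj3_kron tens_map_pure gE => ->.
  by congr (phi3 _); apply: val_inj; rewrite [LHS]ker_val_incl1 -cE.
move=> f1 k2; have [g gE] := qproj_surj (phi2 k2).
have x0 : qproj (bquot2 Pt) (dcF (ker_val k2) + E *: dcF g) = 0.
  by apply/(quot_tangent_ofE _ _ t2); exists k2; split; [reflexivity | exact: gE].
have := bproj3_kron Pt ((dcF f1 + E *: dcF 0) ⊗ (dcF (ker_val k2) + E *: dcF g)).
rewrite tens_map_pure x0 pure0r linear0 kron_dual pure0l linear0 add0r.
move=> /(quot_tangent_ofE _ _ t3) [c [cE]].
rewrite [LHS]bproj3_kron tens_map_pure gE => ->.
by congr (phi3 _); apply: val_inj; rewrite [LHS]ker_val_incl2 -cE.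
Qed.

(** The three deformed kernels define modules over the dual numbers, and the
    equations let [x ⊗ y |-> x ⊗ y] descend to a bilinear map between them; it
    restricts to the given one by construction. *)
Lemma bilin_tangent_hom_of_eqs :
  bilin_tangent_eqs -> bilin_tangent_hom phi1 phi2 phi3.
Proof.
move=> [eqs1 eqs2].
have [M1' [q1 [q1_surj q1E]]] :=
  quotient_module (deformed_ker0 phi1) (@deformed_kerP _ _ _ _ _ phi1).
have [M2' [q2 [q2_surj q2E]]] :=
  quotient_module (deformed_ker0 phi2) (@deformed_kerP _ _ _ _ _ phi2).
have [M3' [q3 [q3_surj q3E]]] :=
  quotient_module (deformed_ker0 (Q := bquot3 P) phi3)
    (@deformed_kerP _ _ _ _ (bquot3 P) phi3).
have p3_kron x y : p3 (kron (x ⊗ y)) = bpi P (p1 x ⊗ p2 y).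
  by rewrite bproj3_kron tens_map_pure.
have h1 x y : q1 x = 0 -> (q3 \o kron) (x ⊗ y) = 0.
  move=> /q1E[c [g [-> gE]]]; have [y1 ->] := dual_row_decomp y.
  set y0 := map_mx _ y; apply/q3E; exists (incl1 P (c ⊗ y0)).
  exists (kron (g ⊗ y0) + kron (ker_val c ⊗ y1)); split.
    by rewrite ker_val_incl1 -kron_dual.
  rewrite [LHS](linearD p3) [X in X + _]p3_kron [X in _ + X]p3_kron gE.
  by rewrite ker_valP pure0l linear0 addr0 [RHS]eqs1.
have h2 x y : q2 y = 0 -> (q3 \o kron) (x ⊗ y) = 0.
  move=> /q2E[c [g [-> gE]]]; have [x1 ->] := dual_row_decomp x.
  set x0 := map_mx _ x; apply/q3E; exists (incl2 P (x0 ⊗ c)).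
  exists (kron (x1 ⊗ ker_val c) + kron (x0 ⊗ g)); split.
    by rewrite ker_val_incl2 -kron_dual.
  rewrite [LHS](linearD p3) [X in X + _]p3_kron [X in _ + X]p3_kron gE.
  by rewrite ker_valP pure0r linear0 add0r [RHS]eqs2.
have [w wE] := tens_factor (h := q3 \o kron) q1_surj q2_surj h1 h2.
have w_surj y : exists t, w t = y.
  have [z <-] := q3_surj y; exists (tens_map q1 q2 (unkron z)).
  by rewrite [LHS]wE -[LHS]/(q3 (kron (unkron z))) unkronK.
pose Q1 := Quot q1_surj (deformed_locally_free q1_surj q1E).
pose Q2 := Quot q2_surj (deformed_locally_free q2_surj q2E).
pose Pt := @Bilin _ n d1 d2 d3 r1 r2 Q1 Q2 M3' w w_surj
  (deformed_locally_free (Q := bquot3 P) q3_surj q3E).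
have Pt3 z : bproj3 Pt z = q3 z.
  by rewrite -{1}(unkronK z) bproj3_kron [LHS]wE
    -[LHS]/(q3 (kron (unkron z))) unkronK.
exists Pt; last first.
  split=> [x|x|x]; [exact: q1E | exact: q2E |].
  by apply: iff_trans (q3E x); rewrite -Pt3.
have [u1 [u1_bc u1E]] := deformed_base_change q1_surj q1E.
have [u2 [u2_bc u2E]] := deformed_base_change q2_surj q2E.
have [u3 [u3_bc u3E]] := deformed_base_change (Q := bquot3 P) q3_surj q3E.
exists P; split; last by split.
exists u1, u2, u3; split; first by split.
split=> [x|x|x y]; [exact: u1E | exact: u2E |].
have [x' <-] := q1_surj x; have [y' <-] := q2_surj y.
have wE' : w (q1 x' ⊗ q2 y') = q3 (kron (x' ⊗ y')).
  by rewrite -tens_map_pure wE.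
by rewrite [bpi Pt _]wE' u3E map_kron u1E u2E [LHS]p3_kron.
Qed.

End BilinTangentSpace.

Theorem proposition3p8 (k : closedFieldType) (n d1 d2 d3 r1 r2 : nat)
    (n_gt0 : (0 < n)%N) (d1_gt0 : (0 < d1)%N) (d2_gt0 : (0 < d2)%N)
    (d3_gt0 : (0 < d3)%N) (r1_gt0 : (0 < r1)%N) (r2_gt0 : (0 < r2)%N)
    (P : bilin k n d1 d2 d3 r1 r2) :
  let F1 := 'rV[mpring k n]_r1 in
  let F2 := 'rV[mpring k n]_r2 in
  let M1 := qmod (bquot1 P) in
  let M2 := qmod (bquot2 P) in
  let M3 := bmod3 P in
  let p1 := qproj (bquot1 P) in
  let p2 := qproj (bquot2 P) in
  let p3 := bproj3 P in
  let pi := bpi P in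
  let K1 := kernel p1 in
  let K2 := kernel p2 in
  let K3 := kernel p3 in
  let j1 := incl1 P in
  let j2 := incl2 P in
  (forall Pt : bilin (dualnum k) n d1 d2 d3 r1 r2, bilin_tangent P Pt ->
     exists (phi1 : {linear K1 -> M1}) (phi2 : {linear K2 -> M2})
            (phi3 : {linear K3 -> M3}),
       bilin_tangent_of phi1 phi2 phi3 Pt /\
       (forall (psi1 : {linear K1 -> M1}) (psi2 : {linear K2 -> M2})
               (psi3 : {linear K3 -> M3}),
          bilin_tangent_of psi1 psi2 psi3 Pt ->
          [/\ psi1 =1 phi1, psi2 =1 phi2 & psi3 =1 phi3])) /\
  (forall (phi1 : {linear K1 -> M1}) (phi2 : {linear K2 -> M2})
          (phi3 : {linear K3 -> M3}),
     (bilin_tangent_hom phi1 phi2 phi3 <->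
        phi3 \o j1 =1 pi \o tens_map idfun p2 \o tens_map phi1 idfun /\
        phi3 \o j2 =1 pi \o tens_map p1 idfun \o tens_map idfun phi2) /\
     (bilin_tangent_hom phi1 phi2 phi3 <->
        (forall (k1 : K1) (f2 : F2), phi3 (j1 (k1 ⊗ f2)) = pi (phi1 k1 ⊗ p2 f2)) /\
        (forall (f1 : F1) (k2 : K2), phi3 (j2 (f1 ⊗ k2)) = pi (p1 f1 ⊗ phi2 k2)))).
Proof.
move=> F1 F2 M1 M2 M3 p1 p2 p3 pi K1 K2 K3 j1 j2; split.
  move=> Pt /bilin_tangent_exists[phi1 [phi2 [phi3 tphi]]].
  exists phi1, phi2, phi3; split=> [|psi1 psi2 psi3]; first exact: tphi.
  have [t1 t2 t3] := tphi => -[t1' t2' t3'].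
  split; [exact: quot_tangent_uniq t1 t1' | exact: quot_tangent_uniq t2 t2' |].
  exact: (@quot_tangent_uniq _ _ _ _ (bquot3 P) _ _ _ t3 t3').
move=> phi1 phi2 phi3.
have homE : bilin_tangent_hom phi1 phi2 phi3 <-> bilin_tangent_eqs phi1 phi2 phi3.
  by split=> [[Pt _ /bilin_tangent_of_eqs]|/bilin_tangent_hom_of_eqs].
split; last exact: homE.
have pure1 (k1 : K1) (f2 : F2) :
    pi (tens_map idfun p2 (tens_map phi1 idfun (k1 ⊗ f2))) = pi (phi1 k1 ⊗ p2 f2).
  exact: (congr1 (fun t => pi t) (tens_map_comp_pure phi1 idfun idfun p2 k1 f2)).
have pure2 (f1 : F1) (k2 : K2) :
    pi (tens_map p1 idfun (tens_map idfun phi2 (f1 ⊗ k2))) = pi (p1 f1 ⊗ phi2 k2).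
  exact: (congr1 (fun t => pi t) (tens_map_comp_pure idfun phi2 p1 idfun f1 k2)).
apply: iff_trans homE _; split=> [[eqs1 eqs2]|[eqs1 eqs2]]; split.
- apply: (@tens_lin_ext _ _ _ _ (phi3 \o j1)
    (pi \o tens_map idfun p2 \o tens_map phi1 idfun)) => k1 f2.
  exact: etrans (eqs1 k1 f2) (esym (pure1 k1 f2)).
- apply: (@tens_lin_ext _ _ _ _ (phi3 \o j2)
    (pi \o tens_map p1 idfun \o tens_map idfun phi2)) => f1 k2.
  exact: etrans (eqs2 f1 k2) (esym (pure2 f1 k2)).
- move=> k1 f2; exact: etrans (eqs1 (k1 ⊗ f2)) (pure1 k1 f2).
move=> f1 k2; exact: etrans (eqs2 (f1 ⊗ k2)) (pure2 f1 k2).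
Qed.
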